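(* Let $\alpha>0$ and assume that $J_{\mathrm{LIML}}\leq F^{-1}_{\chi^2(k-m_w)}(1-\alpha)<\lambda$ (so that $\mathrm{CI}_{\mathrm{AR}}(1-\alpha)$ is bounded and nonempty). Let $S:=\begin{pmatrix}X&W\end{pmatrix}$ and $$s(\kappa):=y^T(\mathrm{Id}_n-\kappa M_Z)y-y^T(\mathrm{Id}_n-\kappa M_Z)S\left(S^T(\mathrm{Id}_n-\kappa M_Z)S\right)^{-1}S^T(\mathrm{Id}_n-\kappa M_Z)y.$$ Let $\kappa_{\mathrm{AR}}(\alpha):=1+F^{-1}_{\chi^2(k-m_w)}(1-\alpha)/(n-k)$ and define $$\alpha_{\mathrm{Wald}\mid\mathrm{AR}}(\alpha):=1-F_{\chi^2(m_x)}\left(-s(\kappa_{\mathrm{AR}}(\alpha))/\hat\sigma^2_{\mathrm{Wald}}(\kappa_{\mathrm{AR}}(\alpha))\right),\qquad\alpha_{\mathrm{LR}\mid\mathrm{AR}}(\alpha):=1-F_{\chi^2(m_x)}\left(F^{-1}_{\chi^2(k-m_w)}(1-\alpha)-J_{\mathrm{LIML}}\right),$$ where $\hat\sigma^2_{\mathrm{Wald}}(\kappa)=\frac1{n-m}\|y-S\hat\beta_{\mathrm{k}}(\kappa)\|^2$. Then $$\mathrm{CI}_{\mathrm{AR}}(1-\alpha)=\mathrm{CI}_{\mathrm{LR}}(1-\alpha_{\mathrm{LR}\mid\mathrm{AR}}(\alpha))=\mathrm{CI}_{\mathrm{Wald},\hat\beta_{\mathrm{k}}(\kappa_{\mathrm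{AR}}(\alpha))}(1-\alpha_{\mathrm{Wald}\mid\mathrm{AR}}(\alpha)).$$
   Context: Data: $y\in\mathbb{R}^n$ (outcomes), $X\in\mathbb{R}^{n\times m_x}$ (endogenous covariates of interest), $W\in\mathbb{R}^{n\times m_w}$ (endogenous covariates not of interest), $Z\in\mathbb{R}^{n\times k}$ (instruments), with $m:=m_x+m_w\leq k<n$, and $S:=\begin{pmatrix}X&W\end{pmatrix}$. For a matrix $A$, $P_A:=A(A^TA)^\dagger A^T$ and $M_A:=\mathrm{Id}-P_A$; $\lambda_{\min}$ is the minimal eigenvalue; $\alpha\in(0,1]$; $F_{\chi^2(r)}$ is the cumulative distribution function of $\chi^2(r)$. $B\in\mathbb{R}^{m_x\times m}$ has ones on the diagonal and zeros elsewhere (so $SB^T=X$). Matrices written with an inverse are implicitly taken to be invertible and denominators nonzero. Subvector Anderson-Rubin statistic: $\mathrm{AR}(\beta):=\min_{\gamma\in\mathbb{R}^{m_w}}\frac{n-k}{k-m_w}\frac{(y-X\beta-W\gamma)^TP_Z(y-X\beta-W\gamma)}{(y-X\beta-W\gamma)^TM_Z(y-X\beta-W\gamma)}$ for $\beta\in\mathbb{R}^{m_x}$; $\mathrm{CI}_{\mathrm{AR}}(1-\alpha):=\{\beta\mid(k-m_w)\mathrm{AR}(\beta)\leq F^{-1}_{\chi^2(k-m_w)}(1-\alpha)\}$. $J_{\mathrm{LIML}}:=(k-m_w)\min_b\mathrm{AR}(b)=(n-k)\lambda_{\min}\left(\left(\begin{pmatrix}S&y\end{pmatrix}^TM_Z\begin{pmatrix}S&y\end{pmatrix}\right)^{-1}\begin{pmatrix}S&y\end{pmatrix}^TP_Z\begin{pmatrix}S&y\end{pmatrix}\right)$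 and $\lambda:=(n-k)\lambda_{\min}\left((S^TM_ZS)^{-1}S^TP_ZS\right)$. Likelihood-ratio statistic: $\mathrm{LR}(\beta):=(k-m_w)\left(\mathrm{AR}(\beta)-\min_{b\in\mathbb{R}^{m_x}}\mathrm{AR}(b)\right)$; $\mathrm{CI}_{\mathrm{LR}}(1-\alpha):=\{\beta\in\mathbb{R}^{m_x}\mid\mathrm{LR}(\beta)\leq F^{-1}_{\chi^2(m_x)}(1-\alpha)\}$. k-class estimator: $\hat\beta_{\mathrm{k}}(\kappa):=\left(S^T(\mathrm{Id}_n-\kappa M_Z)S\right)^\dagger S^T(\mathrm{Id}_n-\kappa M_Z)y\in\mathbb{R}^m$. Subvector Wald statistic centered at it: $$\mathrm{Wald}_{\hat\beta_{\mathrm{k}}(\kappa)}(\beta):=\frac1{\hat\sigma^2_{\mathrm{Wald}}(\kappa)}(\beta-B\hat\beta_{\mathrm{k}}(\kappa))^T\left(B\left(S^T(\mathrm{Id}_n-\kappa M_Z)S\right)^{-1}B^T\right)^{-1}(\beta-B\hat\beta_{\mathrm{k}}(\kappa));$$ $\mathrm{CI}_{\mathrm{Wald},\hat\beta_{\mathrm{k}}(\kappa)}(1-\alpha):=\{\beta\in\mathbb{R}^{m_x}\mid\mathrm{Wald}_{\hat\beta_{\mathrm{k}}(\kappa)}(\beta)\leq F^{-1}_{\chi^2(m_x)}(1-\alpha)\}$. *)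

(* Defs.v *)
From HB Require Import structures.
From mathcomp Require Import all_boot all_order all_algebra.
From mathcomp Require Import all_classical all_reals all_analysis.
Import Order.TTheory GRing.Theory Num.Theory.
Set Implicit Arguments.
Unset Strict Implicit.
Unset Printing Implicit Defensive.
Local Open Scope classical_set_scope.
Local Open Scope ring_scope.

(* Quadratic form v^T A v.  The Euclidean norm is always written
   ||v||^2 = qform 1%:M v, since `|v| on matrices is the sup norm. *)
Definition qform {R : realType} {n : nat} (A : 'M[R]_n) (v : 'cV[R]_n) : R :=
  (v^T *m A *m v) 0 0.

Definition is_mpinv {R : realType} {m n : nat}
    (A : 'M[R]_(m, n)) (G : 'M[R]_(n, m)) : Prop :=
  [/\ A *m G *m A = A, G *m A *m G = G,
      (A *m G)^T = A *m G & (G *m A)^T = G *m A].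

(* Moore-Penrose pseudoinverse; the default 0 is never used, see mpinvP.
   (The library's pinvmx is only a partial inverse.) *)
Definition mpinv {R : realType} {m n : nat} (A : 'M[R]_(m, n)) : 'M[R]_(n, m) :=
  xget 0 [set G | is_mpinv A G].

Lemma is_mpinv_uniq {R : realType} {m n : nat} (A : 'M[R]_(m, n)) G H :
  is_mpinv A G -> is_mpinv A H -> G = H.
Proof.
move=> [AGA GAG sAG sGA] [AHA HAH sAH sHA].
have eAG : A *m G = A *m H.
  have E : A *m H *m (A *m G) = A *m G by rewrite mulmxA AHA.
  by rewrite -sAG -E [LHS]trmx_mul sAG sAH mulmxA AGA.
have eGA : G *m A = H *m A.
  have E : G *m A *m (H *m A) = G *m A by rewrite -mulmxA (mulmxA A) AHA.
  by rewrite -sGA -E [LHS]trmx_mul sGA sHA -mulmxA (mulmxA A) AGA.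
by rewrite -GAG -mulmxA eAG mulmxA eGA HAH.
Qed.

Lemma unitmx_gram {R : realType} {r n : nat} (F : 'M[R]_(r, n)) :
  row_free F -> F *m F^T \in unitmx.
Proof.
move=> Ffree; rewrite -row_free_unit -kermx_eq0; apply/rowV0P => v /sub_kermxP v0.
have w0 : v *m F = 0.
  have : (v *m F) *m (v *m F)^T = 0 by rewrite trmx_mul mulmxA -(mulmxA v) v0 mul0mx.
  move/matrixP/(_ 0 0); rewrite [LHS]mxE [RHS]mxE => /eqP.
  under eq_bigr do rewrite [_^T _ _]mxE -expr2.
  rewrite psumr_eq0 => [/allP h|i _]; last exact: sqr_ge0.
  apply/rowP => j; apply/eqP; rewrite [X in _ == X]mxE -sqrf_eq0.
  exact: h (mem_index_enum j).
by apply/eqP; rewrite -(mulmx_free_eq0 v Ffree) w0.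
Qed.

Lemma is_mpinv_mul {R : realType} {m r n : nat}
    (C : 'M[R]_(m, r)) (F : 'M[R]_(r, n)) :
  row_free C^T -> row_free F ->
  is_mpinv (C *m F)
    (F^T *m invmx (F *m F^T) *m (invmx (C^T *m C) *m C^T)).
Proof.
move=> /unitmx_gram; rewrite trmxK => uC /unitmx_gram uF.
set iF := invmx (F *m F^T); set iC := invmx (C^T *m C).
have FF : F *m (F^T *m iF) = 1%:M by rewrite mulmxA mulmxV.
have CC : (iC *m C^T) *m C = 1%:M by rewrite -mulmxA mulVmx.
have siF : iF^T = iF by rewrite /iF trmx_inv trmx_mul trmxK.
have siC : iC^T = iC by rewrite /iC trmx_inv trmx_mul trmxK.
set G := F^T *m iF *m (iC *m C^T).
have AG : C *m F *m G = C *m (iC *m C^T).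
  by rewrite /G -mulmxA (mulmxA F) FF mul1mx.
have GA : G *m (C *m F) = F^T *m iF *m F.
  by rewrite /G -mulmxA (mulmxA _ C F) CC mul1mx.
split.
- by rewrite AG -mulmxA (mulmxA _ C F) CC mul1mx.
- by rewrite GA /G -[_ *m F *m _]mulmxA (mulmxA F) FF mul1mx.
- by rewrite AG !trmx_mul trmxK siC mulmxA.
- by rewrite GA !trmx_mul trmxK siF mulmxA.
Qed.

Lemma mpinvP {R : realType} {m n : nat} (A : 'M[R]_(m, n)) : is_mpinv A (mpinv A).
Proof.
have : exists G, is_mpinv (col_base A *m row_base A) G.
  eexists; apply: is_mpinv_mul; last exact: row_base_free.
  by rewrite /row_free mxrank_tr; exact: col_base_full.
by rewrite mulmx_base => -[G HG]; exact: (xgetI 0 HG).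
Qed.

(* P_A; M_A below is annm A *)
Definition projm {R : realType} {n p : nat} (A : 'M[R]_(n, p)) : 'M[R]_n :=
  A *m mpinv (A^T *m A) *m A^T.

Definition annm {R : realType} {n p : nat} (A : 'M[R]_(n, p)) : 'M[R]_n :=
  1%:M - projm A.

(* The matrices to which this is applied are not symmetric, but they have a
   nonempty finite set of eigenvalues, all real; inf is then the minimum. *)
Definition lambda_min {R : realType} {n : nat} (A : 'M[R]_n) : R :=
  inf [set a : R | eigenvalue A a].

Definition gamma_fun {R : realType} (a : R) : R :=
  \int[@lebesgue_measure R]_(t in `]0, +oo[) (t `^ (a - 1) * expR (- t)).

Definition chi2_pdf {R : realType} (r : nat) (x : R) : R :=
  if 0 < x then
    x `^ (r%:R / 2 - 1) * expR (- (x / 2)) / (2 `^ (r%:R / 2) * gamma_fun (r%:R / 2))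
  else 0.

(* Only used with r > 0 *)
Definition chi2_cdf {R : realType} (r : nat) (x : R) : R :=
  \int[@lebesgue_measure R]_(t in `]-oo, x]) chi2_pdf r t.

(* Quantile function on the support: for r > 0 and 0 <= p < 1 this is the
   unique x >= 0 with chi2_cdf r x = p; in particular it is 0 at p = 0. *)
Definition chi2_quantile {R : realType} (r : nat) (p : R) : R :=
  inf [set x : R | 0 <= x /\ p <= chi2_cdf r x].

(* Throughout, X : n x mx (covariates of interest), W : n x mw, Z : n x k,
   y : n x 1, and S = row_mx X W. *)

(* The minimum over gamma is rendered as an infimum: for some beta it is only
   approached as gamma goes to infinity, and it agrees with min when attained.
   The same applies to the minimum over beta in minAR. *)
Definition AR {R : realType} {n mx mw k : nat} (X : 'M[R]_(n, mx))
    (W : 'M[R]_(n, mw)) (Z : 'M[R]_(n, k)) (y : 'cV[R]_n) (beta : 'cV[R]_mx) : R :=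
  inf (range (fun gamma : 'cV[R]_mw =>
    (n - k)%:R / (k - mw)%:R
      * (qform (projm Z) (y - X *m beta - W *m gamma)
         / qform (annm Z) (y - X *m beta - W *m gamma)))).

Definition minAR {R : realType} {n mx mw k : nat} (X : 'M[R]_(n, mx))
    (W : 'M[R]_(n, mw)) (Z : 'M[R]_(n, k)) (y : 'cV[R]_n) : R :=
  inf (range (AR X W Z y)).

Definition J_LIML {R : realType} {n mx mw k : nat} (X : 'M[R]_(n, mx))
    (W : 'M[R]_(n, mw)) (Z : 'M[R]_(n, k)) (y : 'cV[R]_n) : R :=
  (k - mw)%:R * minAR X W Z y.

Definition lambda_stat {R : realType} {n m k : nat}
    (S : 'M[R]_(n, m)) (Z : 'M[R]_(n, k)) : R :=
  (n - k)%:R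
    * lambda_min (invmx (S^T *m annm Z *m S) *m (S^T *m projm Z *m S)).

Definition LR {R : realType} {n mx mw k : nat} (X : 'M[R]_(n, mx))
    (W : 'M[R]_(n, mw)) (Z : 'M[R]_(n, k)) (y : 'cV[R]_n) (beta : 'cV[R]_mx) : R :=
  (k - mw)%:R * (AR X W Z y beta - minAR X W Z y).

(* Id_n - kappa M_Z *)
Definition kmat {R : realType} {n k : nat} (Z : 'M[R]_(n, k)) (kappa : R) : 'M[R]_n :=
  1%:M - kappa *: annm Z.

Definition beta_k {R : realType} {n m k : nat} (S : 'M[R]_(n, m))
    (Z : 'M[R]_(n, k)) (y : 'cV[R]_n) (kappa : R) : 'cV[R]_m :=
  mpinv (S^T *m kmat Z kappa *m S) *m (S^T *m kmat Z kappa *m y).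

Definition sigma2_Wald {R : realType} {n m k : nat} (S : 'M[R]_(n, m))
    (Z : 'M[R]_(n, k)) (y : 'cV[R]_n) (kappa : R) : R :=
  (n - m)%:R^-1 * qform 1%:M (y - S *m beta_k S Z y kappa).

Definition selB (R : realType) (mx mw : nat) : 'M[R]_(mx, mx + mw) := pid_mx mx.

Lemma selBE {R : realType} {n mx mw : nat} (X : 'M[R]_(n, mx)) (W : 'M[R]_(n, mw)) :
  row_mx X W *m (selB R mx mw)^T = X.
Proof.
have -> : selB R mx mw = row_mx 1%:M 0 by rewrite /selB pid_mx_row.
by rewrite tr_row_mx mul_row_col trmx1 mulmx1 trmx0 mulmx0 addr0.
Qed.

Definition Wald {R : realType} {n mx mw k : nat} (X : 'M[R]_(n, mx))
    (W : 'M[R]_(n, mw)) (Z : 'M[R]_(n, k)) (y : 'cV[R]_n) (kappa : R)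
    (beta : 'cV[R]_mx) : R :=
  let S := row_mx X W in
  let B := selB R mx mw in
  (sigma2_Wald S Z y kappa)^-1
    * qform (invmx (B *m invmx (S^T *m kmat Z kappa *m S) *m B^T))
            (beta - B *m beta_k S Z y kappa).

(* In the three confidence sets, p is the coverage level (p = 1 - alpha). *)

Definition CI_AR {R : realType} {n mx mw k : nat} (X : 'M[R]_(n, mx))
    (W : 'M[R]_(n, mw)) (Z : 'M[R]_(n, k)) (y : 'cV[R]_n) (p : R) : set 'cV[R]_mx :=
  [set beta | (k - mw)%:R * AR X W Z y beta <= chi2_quantile (k - mw) p].

Definition CI_LR {R : realType} {n mx mw k : nat} (X : 'M[R]_(n, mx))
    (W : 'M[R]_(n, mw)) (Z : 'M[R]_(n, k)) (y : 'cV[R]_n) (p : R) : set 'cV[R]_mx :=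
  [set beta | LR X W Z y beta <= chi2_quantile mx p].

Definition CI_Wald {R : realType} {n mx mw k : nat} (X : 'M[R]_(n, mx))
    (W : 'M[R]_(n, mw)) (Z : 'M[R]_(n, k)) (y : 'cV[R]_n) (kappa : R) (p : R) :
    set 'cV[R]_mx :=
  [set beta | Wald X W Z y kappa beta <= chi2_quantile mx p].

Definition s_k {R : realType} {n m k : nat} (S : 'M[R]_(n, m))
    (Z : 'M[R]_(n, k)) (y : 'cV[R]_n) (kappa : R) : R :=
  let K := kmat Z kappa in
  (y^T *m K *m y - y^T *m K *m S *m invmx (S^T *m K *m S) *m (S^T *m K *m y)) 0 0.

Definition kappa_AR {R : realType} (n k mw : nat) (alpha : R) : R :=
  1 + chi2_quantile (k - mw) (1 - alpha) / (n - k)%:R.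

Definition alpha_Wald_AR {R : realType} {n mx mw k : nat} (X : 'M[R]_(n, mx))
    (W : 'M[R]_(n, mw)) (Z : 'M[R]_(n, k)) (y : 'cV[R]_n) (alpha : R) : R :=
  let S := row_mx X W in
  let kappa := kappa_AR n k mw alpha in
  1 - chi2_cdf mx (- s_k S Z y kappa / sigma2_Wald S Z y kappa).

Definition alpha_LR_AR {R : realType} {n mx mw k : nat} (X : 'M[R]_(n, mx))
    (W : 'M[R]_(n, mw)) (Z : 'M[R]_(n, k)) (y : 'cV[R]_n) (alpha : R) : R :=
  1 - chi2_cdf mx (chi2_quantile (k - mw) (1 - alpha) - J_LIML X W Z y).

(* Main.v *)
Require Import Defs.
From mathcomp Require Import all_boot all_order all_algebra.
From mathcomp Require Import all_classical all_reals all_analysis.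
From mathcomp Require Import measurable_realfun ring lra.
Import Order.TTheory GRing.Theory Num.Theory.
Import numFieldNormedType.Exports.
Local Open Scope classical_set_scope.
Local Open Scope ring_scope.
Set Implicit Arguments.
Unset Strict Implicit.
Unset Printing Implicit Defensive.

(** All three confidence sets are one sublevel set of a single quadratic form.

    Write c for the quantile that defines the Anderson-Rubin set, d = c / (n - k)
    and K = P_Z - d M_Z, which is Id - kappa M_Z for kappa = 1 + d.  A ratio
    v^T P_Z v / v^T M_Z v is at most d exactly when v^T K v <= 0, so beta should
    lie in the Anderson-Rubin set exactly when some gamma makes the K-form of
    y - X beta - W gamma nonpositive ([AR_le_iff]).  The point that needs care
    is that AR is an infimum over gamma, perhaps not attained.  The assumption
    c < lambda makes S^T K S positive definite ([pdmx_lambda_min]); hence if the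
    K-form is positive at every residual, it is positive definite on the whole
    span of W and y - X beta and dominates a multiple e of the M_Z-form there, which
    keeps every ratio above d + e ([ratio_gap]).

    Completing the square around the k-class estimator ([kclass_residual]) writes
    the K-form of y - S b as s(kappa) plus the (S^T K S)-form of b minus the
    estimator.  Minimizing over the gamma block of b turns that form into the
    numerator of the Wald statistic ([constrained_min]), so
    beta is in the Anderson-Rubin set iff this numerator is at most - s(kappa)
    ([partial_residual_le]).  The likelihood-ratio statistic differs from
    (k - m_w) AR by the constant J_LIML, so its set is the Anderson-Rubin set
    as soon as the critical value is c - J_LIML.

    It remains to see that the critical values at the levels alpha_LR|AR and
    alpha_Wald|AR are c - J_LIML and - s(kappa) / sigma^2, that is, that the
    chi-square quantile undoes the distribution function at a nonnegative
    argument ([chi2_cdfK]).  Both arguments are nonnegative because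
    J_LIML <= c; for the second, the gap argument used with all of S shows that
    some residual has nonpositive K-form, whence s(kappa) <= 0
    ([J_LIML_residual_le0]).  The quantile identity rests on strict monotonicity
    of the distribution function, and this on the integrability of the gamma
    density, which is dominated by a log-logistic density
    ([integrable_gamma_density]). *)

(** * Quadratic forms and positive definite matrices *)

Definition bform {R : realType} {n : nat} (A : 'M[R]_n) (x y : 'cV[R]_n) : R :=
  (x^T *m A *m y) 0 0.

Definition psdmx {R : realType} {n : nat} (A : 'M[R]_n) : Prop :=
  A^T = A /\ forall x, 0 <= qform A x.

Definition pdmx {R : realType} {n : nat} (A : 'M[R]_n) : Prop :=
  A^T = A /\ forall x, x != 0 -> 0 < qform A x.

Lemma pdmx_psdmx (R : realType) n (A : 'M[R]_n) : pdmx A -> psdmx A.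
Proof.
move=> [sA pA]; split=> // x.
have [->|/pA/ltW//] := eqVneq x 0.
by rewrite /qform mulmx0 mxE.
Qed.

Lemma bform_sym (R : realType) n (A : 'M[R]_n) x y : A^T = A -> bform A x y = bform A y x.
Proof.
move=> sA; rewrite /bform.
have -> : x^T *m A *m y = (y^T *m A *m x)^T by rewrite !trmx_mul trmxK sA mulmxA.
by rewrite mxE.
Qed.

Lemma bformDr (R : realType) n (A : 'M[R]_n) x y z :
  bform A x (y + z) = bform A x y + bform A x z.
Proof. by rewrite /bform mulmxDr mxE. Qed.

Lemma bformZr (R : realType) n (A : 'M[R]_n) x t y : bform A x (t *: y) = t * bform A x y.
Proof. by rewrite /bform -scalemxAr mxE. Qed.

Lemma bformDl (R : realType) n (A : 'M[R]_n) x y z :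
  bform A (x + y) z = bform A x z + bform A y z.
Proof. by rewrite /bform raddfD /= !mulmxDl mxE. Qed.

Lemma bformZl (R : realType) n (A : 'M[R]_n) t x y : bform A (t *: x) y = t * bform A x y.
Proof. by rewrite /bform linearZ /= -!scalemxAl mxE. Qed.

Lemma qformD (R : realType) n (A : 'M[R]_n) x y : A^T = A ->
  qform A (x + y) = qform A x + 2 * bform A x y + qform A y.
Proof.
move=> sA; rewrite -![qform A _]/(bform A _ _) bformDl !bformDr.
by rewrite (@bform_sym _ _ A y x)//; ring.
Qed.

Lemma qformZ (R : realType) n (A : 'M[R]_n) t x : qform A (t *: x) = t ^+ 2 * qform A x.
Proof.
by rewrite -![qform A _]/(bform A _ _) bformZl bformZr mulrA.
Qed.

Lemma qform_mul (R : realType) n p (A : 'M[R]_n) (T : 'M[R]_(n, p)) u :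
  qform A (T *m u) = qform (T^T *m A *m T) u.
Proof. by rewrite /qform trmx_mul !mulmxA. Qed.

Lemma qform_subZ (R : realType) n (A B : 'M[R]_n) t x :
  qform (A - t *: B) x = qform A x - t * qform B x.
Proof.
by rewrite /qform mulmxBr mulmxBl -scalemxAr -scalemxAl !mxE.
Qed.

Lemma pdmx_unit (R : realType) n (A : 'M[R]_n) : pdmx A -> A \in unitmx.
Proof.
move=> [_ pA]; rewrite -row_free_unit -kermx_eq0; apply/rowV0P => v /sub_kermxP v0.
apply/eqP; apply: contraT => vn0.
have : v^T != 0 by rewrite -(inj_eq trmx_inj) trmxK trmx0.
by move/pA; rewrite /qform trmxK v0 mul0mx mxE ltxx.
Qed.

(** The form is nonnegative at [qform A y *: x - bform A x y *: y], which gives the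
    inequality multiplied by [qform A y].  When that factor vanishes, the form is
    affine along the line [x + t y], so it can stay nonnegative only if its slope
    [bform A x y] is 0. *)
Lemma psdmx_cauchy_schwarz (R : realType) n (A : 'M[R]_n) x y : psdmx A ->
  bform A x y ^+ 2 <= qform A x * qform A y.
Proof.
move=> [sA pA].
have E (s t : R) : 0 <= s ^+ 2 * qform A x + 2 * (s * t * bform A x y) + t ^+ 2 * qform A y.
  have := pA (s *: x + t *: y).
  by rewrite qformD// !qformZ bformZl bformZr !mulrA.
have := pA y; rewrite le_eqVlt => /orP[/eqP q0|q0].
  have [->|b0] := eqVneq (bform A x y) 0; first by rewrite expr0n /= -q0 mulr0.
  have := E 1 (- (qform A x + 1) / (2 * bform A x y)).
  rewrite -q0 mulr0 addr0 expr1n !mul1r.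
  have -> : 2 * (- (qform A x + 1) / (2 * bform A x y) * bform A x y)
            = - (qform A x + 1) by field.
  lra.
have := E (qform A y) (- bform A x y).
have -> : qform A y ^+ 2 * qform A x + 2 * (qform A y * - bform A x y * bform A x y) +
  (- bform A x y) ^+ 2 * qform A y
   = qform A y * (qform A x * qform A y - bform A x y ^+ 2) by ring.
by rewrite pmulr_rge0// subr_ge0.
Qed.

(** By Cauchy-Schwarz, an isotropic vector of a semidefinite form lies in the kernel
    of its matrix. *)
Lemma psdmx_unit_pdmx (R : realType) n (A : 'M[R]_n) : psdmx A -> A \in unitmx -> pdmx A.
Proof.
move=> pA uA; split; first exact: pA.1.
move=> x xn0; rewrite lt_def pA.2 andbT; apply: contra xn0 => /eqP qx.
have b0 y : bform A y x = 0.
  apply/eqP; rewrite -sqrf_eq0 eq_le sqr_ge0 andbT.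
  by have := psdmx_cauchy_schwarz y x pA; rewrite qx mulr0.
have Ax : A *m x = 0.
  apply/colP => i; rewrite [RHS]mxE -(b0 (delta_mx i 0)) /bform trmx_delta -mulmxA.
  by rewrite -rowE [RHS]mxE.
by rewrite -(mulKmx uA x) Ax mulmx0.
Qed.

(** The i-th coordinate of x is the A-product of x with [A^-1 e_i], so by
    Cauchy-Schwarz its square is bounded by a multiple of the A-form; every
    form is bounded by a combination of squared coordinates.  This replaces a
    compactness argument on the unit sphere. *)
Lemma pdmx_dominates (R : realType) n (A B : 'M[R]_n) : pdmx A ->
  exists2 e : R, 0 < e & forall x, e * qform B x <= qform A x.
Proof.
move=> pA; have [sA qA] := pdmx_psdmx pA.
pose c i := qform A (invmx A *m delta_mx i 0).
have cx i (x : 'cV_n) : x i 0 ^+ 2 <= c i * qform A x.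
  apply: le_trans (psdmx_cauchy_schwarz _ x (pdmx_psdmx pA)).
  rewrite /bform trmx_mul trmx_inv sA trmx_delta -!mulmxA mulKmx ?pdmx_unit//.
  by rewrite -rowE mxE.
pose C := \sum_i \sum_j `|B i j| * (c i + c j).
have C0 : 0 <= C.
  by apply: sumr_ge0 => i _; apply: sumr_ge0 => j _; rewrite mulr_ge0// addr_ge0 ?qA.
have BC x : qform B x <= C * qform A x.
  rewrite /qform mxE (eq_bigr (fun j => \sum_i x i 0 * B i j * x j 0)); last first.
    by move=> j _; rewrite mxE mulr_suml; apply: eq_bigr => i _; rewrite mxE.
  rewrite exchange_big /= mulr_suml; apply: ler_sum => i _.
  rewrite mulr_suml; apply: ler_sum => j _.
  apply: (@le_trans _ _ (`|B i j| * (x i 0 ^+ 2 + x j 0 ^+ 2))).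
    rewrite mulrAC [leLHS]mulrC; apply: (le_trans (ler_norm _)).
    rewrite normrM ler_wpM2l// ler_norml; apply/andP; split; nra.
  by rewrite -mulrA ler_wpM2l// mulrDl lerD.
exists (1 + C)^-1; first by rewrite invr_gt0 ltr_wpDr.
move=> x; rewrite mulrC ler_pdivrMr ?ltr_wpDr//.
by rewrite mulrDr mulr1 (mulrC _ C) (le_trans (BC x))// lerDr.
Qed.

(** Let t be the largest number with A - t D positive semidefinite.  By
    [pdmx_dominates], A - t D cannot be definite, so it is singular and t is an
    eigenvalue of D^-1 A; thus d < lambda_min <= t. *)
Lemma pdmx_lambda_min (R : realType) n (A D : 'M[R]_n) d : psdmx A -> pdmx D ->
  d < lambda_min (invmx D *m A) -> pdmx (A - d *: D).
Proof.
move=> pA pD dl.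
have sAt t : (A - t *: D)^T = A - t *: D by rewrite linearB linearZ /= pA.1 pD.1.
split=> // x xn0.
have qDx := pD.2 x xn0.
pose E := [set t : R | forall x, 0 <= qform (A - t *: D) x].
have E0 : E 0 by move=> z; rewrite scale0r subr0 pA.2.
have Eub t : E t -> t <= qform A x / qform D x.
  by move=> /(_ x); rewrite qform_subZ subr_ge0 ler_pdivlMr.
have hE : has_sup E by split; [exists 0 | exists (qform A x / qform D x) => t /Eub].
have Esup : E (sup E).
  move=> z; rewrite qform_subZ subr_ge0.
  have [->|zn0] := eqVneq z 0; first by rewrite /qform !mulmx0 !mxE mulr0.
  rewrite -ler_pdivlMr; last exact: pD.2.
  apply: ge_sup; first by exists 0.
  by move=> t /(_ z); rewrite qform_subZ subr_ge0 ler_pdivlMr// pD.2.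
(* if definite, [pdmx_dominates] would leave room to increase t *)
have nu : A - sup E *: D \notin unitmx.
  apply/negP => uE; have pE : pdmx (A - sup E *: D) by apply: psdmx_unit_pdmx.
  have [e e0 eD] := pdmx_dominates D pE.
  suff : sup E + e <= sup E by rewrite gerDl leNgt e0.
  apply: sup_upper_bound => // z.
  by have := eD z; rewrite !qform_subZ mulrDl; lra.
have ev : eigenvalue (invmx D *m A) (sup E).
  apply: contraR nu; rewrite /eigenvalue /eigenspace /= negbK kermx_eq0 row_free_unit.
  have -> : invmx D *m A - (sup E)%:M = invmx D *m (A - sup E *: D).
    by rewrite mulmxBr -scalemxAr mulVmx ?pdmx_unit// scalemx1.
  by rewrite unitmx_mul => /andP[].
(* a nonempty set without a lower bound would have infimum 0 *)
have lb : lbound [set a : R | eigenvalue (invmx D *m A) a] 0.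
  move=> a /eigenvalueP[v /(congr1 (fun w => w *m invmx D)) va vn0].
  move: va; rewrite -scalemxAl => va.
  have w0 : (v *m invmx D)^T != 0.
    rewrite -(inj_eq trmx_inj) trmxK trmx0.
    apply: contra vn0 => /eqP w0.
    by rewrite -(mulmxKV (pdmx_unit pD) v) w0 mul0mx.
  have := pA.2 (v *m invmx D)^T; rewrite /qform trmxK -!mulmxA (mulmxA _ A) (mulmxA v).
  have -> : v *m (invmx D *m A) = a *: v.
    move: va => /(congr1 (fun w => w *m D)).
    by rewrite -scalemxAl !mulmxKV ?pdmx_unit.
  rewrite -scalemxAl mxE => h.
  have := pD.2 _ w0; rewrite /qform trmxK mulmxKV ?pdmx_unit// => h'.
  by rewrite -(pmulr_lge0 _ h').
have : d < sup E by apply: lt_le_trans dl _; apply: ge_inf => //; exists 0.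
move=> dE; have := Esup x; rewrite !qform_subZ; nra.
Qed.

Lemma psdmx_congr (R : realType) n p (A : 'M[R]_n) (T : 'M[R]_(n, p)) :
  psdmx A -> psdmx (T^T *m A *m T).
Proof.
move=> [sA pA]; split; first by rewrite !trmx_mul trmxK sA mulmxA.
by move=> x; rewrite -qform_mul.
Qed.

Lemma pdmx_congr (R : realType) n p (A : 'M[R]_n) (T : 'M[R]_(n, p)) :
  pdmx A -> (forall u : 'cV_p, T *m u = 0 -> u = 0) -> pdmx (T^T *m A *m T).
Proof.
move=> pA Tinj; split; first exact: (psdmx_congr T (pdmx_psdmx pA)).1.
move=> x xn0; rewrite -qform_mul; apply: pA.2.
by apply: contra xn0 => /eqP/Tinj/eqP.
Qed.

Lemma pdmx_inv (R : realType) n (A : 'M[R]_n) : pdmx A -> pdmx (invmx A).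
Proof.
move=> pA; have uA := pdmx_unit pA.
have -> : invmx A = (invmx A)^T *m A *m invmx A.
  by rewrite trmx_inv pA.1 mulVmx// mul1mx.
apply: pdmx_congr => // u /(congr1 (mulmx A)).
by rewrite mulKVmx// mulmx0.
Qed.

(** The minimizer of the G-form on [B u = delta] is [u0 = G^-1 B^T V^-1 delta] with
    V = B G^-1 B^T: the vector [G u0] is in the range of B^T, so u0 is
    G-orthogonal to the kernel of B. *)
Lemma constrained_min (R : realType) m p (G : 'M[R]_m) (B : 'M[R]_(p, m))
    (delta : 'cV[R]_p) (r : R) :
  pdmx G -> (forall u : 'cV_p, B^T *m u = 0 -> u = 0) ->
  (exists2 u : 'cV_m, B *m u = delta & qform G u <= r) <->
  qform (invmx (B *m invmx G *m B^T)) delta <= r.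
Proof.
move=> pG Binj; set V := B *m invmx G *m B^T.
have uG := pdmx_unit pG.
have pV : pdmx V.
  by have := pdmx_congr (pdmx_inv pG) Binj; rewrite trmxK.
have uV := pdmx_unit pV.
pose u0 := invmx G *m B^T *m invmx V *m delta.
have Bu0 : B *m u0 = delta.
  by rewrite /u0 !mulmxA -/V mulmxV// mul1mx.
have Gu0 : G *m u0 = B^T *m (invmx V *m delta).
  by rewrite /u0 !mulmxA mulmxV// mul1mx.
have cross w : bform G w u0 = bform (invmx V) (B *m w) delta.
  by rewrite /bform trmx_mul -!mulmxA Gu0.
have qu0 : qform G u0 = qform (invmx V) delta.
  by rewrite -[LHS]/(bform G u0 u0) cross Bu0.
split=> [[u Bu qu]|qd]; last by exists u0; rewrite ?qu0.
have := (pdmx_psdmx pG).2 (u - u0).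
rewrite -scaleN1r qformD ?pG.1// qformZ bformZr cross Bu qu0.
rewrite -[bform _ _ _]/(qform (invmx V) delta); lra.
Qed.

(** * Projections and k-class residuals *)

Lemma mpinv_sym (R : realType) n (A : 'M[R]_n) : A^T = A -> (mpinv A)^T = mpinv A.
Proof.
move=> sA; apply: is_mpinv_uniq (mpinvP A).
have [a b c d] := mpinvP A; split.
- by rewrite -[RHS]sA -[in RHS]a !trmx_mul sA mulmxA.
- by rewrite -[in RHS]b !trmx_mul sA mulmxA.
- by move: d; rewrite !trmx_mul trmxK sA => ->.
- by move: c; rewrite !trmx_mul trmxK sA => ->.
Qed.

Lemma mpinv_unitmx (R : realType) n (A : 'M[R]_n) : A \in unitmx -> mpinv A = invmx A.
Proof.
move=> uA; apply: is_mpinv_uniq (mpinvP A) _.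
by split; rewrite ?mulmxV ?mulVmx ?mul1mx ?trmx1.
Qed.

Lemma projm_sym (R : realType) n k (Z : 'M[R]_(n, k)) : (projm Z)^T = projm Z.
Proof.
by rewrite /projm !trmx_mul trmxK mpinv_sym ?mulmxA// trmx_mul trmxK.
Qed.

Lemma projm_idem (R : realType) n k (Z : 'M[R]_(n, k)) :
  projm Z *m projm Z = projm Z.
Proof.
have [_ GAG _ _] := mpinvP (Z^T *m Z).
by rewrite /projm -[in RHS]GAG !mulmxA.
Qed.

Lemma idempotent_psdmx (R : realType) n (P : 'M[R]_n) : P^T = P -> P *m P = P -> psdmx P.
Proof.
move=> sP PP; have -> : P = P^T *m 1%:M *m P by rewrite sP mulmx1 PP.
apply: psdmx_congr; split; first exact: trmx1.
move=> x; rewrite /qform mulmx1 mxE; apply: sumr_ge0 => i _.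
by rewrite mxE -expr2 sqr_ge0.
Qed.

Lemma projm_psdmx (R : realType) n k (Z : 'M[R]_(n, k)) : psdmx (projm Z).
Proof. exact: idempotent_psdmx (projm_sym Z) (projm_idem Z). Qed.

Lemma annm_psdmx (R : realType) n k (Z : 'M[R]_(n, k)) : psdmx (annm Z).
Proof.
apply: idempotent_psdmx; first by rewrite /annm linearB /= trmx1 projm_sym.
by rewrite /annm mulmxBl !mulmxBr !mulmx1 !mul1mx projm_idem subrr subr0.
Qed.

Lemma kmatE (R : realType) n k (Z : 'M[R]_(n, k)) d :
  kmat Z (1 + d) = projm Z - d *: annm Z.
Proof.
by rewrite /kmat scalerDl scale1r opprD addrA {1}/annm subKr.
Qed.

(** Homogenization: a vector of the span of T and v is either in the range of T or
    a nonzero multiple of some [v - T u], so the form is positive definite on the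
    span and [pdmx_dominates] applies there. *)
Lemma affine_dominates (R : realType) n p (K M : 'M[R]_n) (T : 'M[R]_(n, p))
    (v : 'cV[R]_n) :
  K^T = K -> pdmx (T^T *m K *m T) -> (forall u, 0 < qform K (v - T *m u)) ->
  exists2 e : R, 0 < e & forall u, e * qform M (v - T *m u) <= qform K (v - T *m u).
Proof.
move=> sK pT pv; pose Q := row_mx T v.
have QE (u : 'cV_p) (t : R) : Q *m col_mx u t%:M = T *m u + t *: v.
  by rewrite mul_row_col mul_mx_scalar.
have pQ : pdmx (Q^T *m K *m Q).
  split; first by rewrite !trmx_mul trmxK sK mulmxA.
  move=> x; rewrite -[x]vsubmxK [dsubmx x]mx11_scalar; move: (usubmx x) (dsubmx x 0 0).
  move=> u t xn0; rewrite -qform_mul QE.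
  have [t0|t0] := eqVneq t 0.
    rewrite t0 scale0r addr0 qform_mul; apply: pT.2.
    by apply: contra xn0 => /eqP ->; rewrite t0 raddf0 col_mx0.
  have -> : T *m u + t *: v = t *: (v - T *m (- t^-1 *: u)).
    by rewrite -scalemxAr scaleNr opprK scalerDr scalerA mulfV// scale1r addrC.
  by rewrite qformZ pmulr_rgt0// exprn_even_gt0.
have [e e0 eM] := pdmx_dominates (Q^T *m M *m Q) pQ.
exists e => // u; have := eM (col_mx (- u) 1%:M).
by rewrite -!qform_mul QE mulmxN scale1r addrC.
Qed.

(** Positivity at every u gives ratios above d; the uniform gap e is what
    survives passing to an infimum that need not be attained. *)
Lemma ratio_gap (R : realType) n p (P M : 'M[R]_n) (d : R) (T : 'M[R]_(n, p))
    (v : 'cV[R]_n) :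
  P^T = P -> M^T = M -> pdmx (T^T *m (P - d *: M) *m T) ->
  (forall u, 0 < qform M (v - T *m u)) ->
  (forall u, 0 < qform (P - d *: M) (v - T *m u)) ->
  exists2 e : R, 0 < e &
    forall u, d + e <= qform P (v - T *m u) / qform M (v - T *m u).
Proof.
move=> sP sM pT Mv Kv.
have sK : (P - d *: M)^T = P - d *: M by rewrite linearB linearZ /= sP sM.
have [e e0 eM] := affine_dominates M sK pT Kv.
exists e => // u; rewrite ler_pdivlMr//.
by have := eM u; rewrite qform_subZ; lra.
Qed.

(** Completing the square in b; the second summand vanishes at the k-class estimator. *)
Lemma kclass_residual (R : realType) n m (K : 'M[R]_n) (S : 'M[R]_(n, m))
    (y : 'cV[R]_n) (b : 'cV[R]_m) :
  let G := S^T *m K *m S in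
  K^T = K -> G \in unitmx ->
  qform K (y - S *m b) =
    (y^T *m K *m y - y^T *m K *m S *m invmx G *m (S^T *m K *m y)) 0 0
    + qform G (b - invmx G *m (S^T *m K *m y)).
Proof.
move=> G sK uG; set h := invmx G *m _.
have sG : G^T = G by rewrite /G !trmx_mul trmxK sK mulmxA.
have Gh : G *m h = S^T *m K *m y by rewrite /h mulKVmx.
have hT : h^T = y^T *m K *m S *m invmx G.
  by rewrite /h !trmx_mul trmxK sK trmx_inv sG !mulmxA.
have e1 : (y^T *m K *m y - y^T *m K *m S *m invmx G *m (S^T *m K *m y)) 0 0
          = qform K y - qform G h.
  by rewrite -hT -Gh /qform mxE [X in _ + X]mxE !mulmxA.
rewrite e1 -[y - _]addrC -scaleN1r -[b - h]addrC -(scaleN1r h).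
rewrite !qformD// !qformZ !bformZl qform_mul -/G.
have -> : bform K (S *m b) y = bform G h b.
  by rewrite [RHS]bform_sym// /bform -(mulmxA b^T G) Gh trmx_mul !mulmxA.
ring.
Qed.

(** A semidefinite Gram matrix that is invertible is definite, which also gives
    linear independence of the columns of S and y modulo the kernel of M. *)
Lemma unitmx_residual_gt0 (R : realType) n m (S : 'M[R]_(n, m)) (M : 'M[R]_n)
    (y : 'cV[R]_n) :
  psdmx M -> (row_mx S y)^T *m M *m row_mx S y \in unitmx ->
  pdmx (S^T *m M *m S) /\ forall b, 0 < qform M (y - S *m b).
Proof.
move=> pM uQ.
have pQ : pdmx ((row_mx S y)^T *m M *m row_mx S y).
  by apply: psdmx_unit_pdmx => //; exact: psdmx_congr.
split.
  split; first exact: (psdmx_congr S pM).1.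
  move=> u un0; have := pQ.2 (col_mx u 0).
  rewrite -qform_mul mul_row_col mulmx0 addr0 qform_mul; apply.
  by apply: contra un0 => /eqP; rewrite -(col_mx0 R m 1) => /eq_col_mx[->].
move=> b; have := pQ.2 (col_mx (- b) 1%:M).
rewrite -qform_mul mul_row_col mulmx1 mulmxN addrC; apply.
apply/eqP; rewrite -(col_mx0 R m 1) => /eq_col_mx[_ /matrixP/(_ 0 0)].
by rewrite !mxE eqxx => /eqP; rewrite oner_eq0.
Qed.

(** * The Anderson-Rubin statistic and the partial residual *)

Lemma residualE (R : realType) n mx mw (X : 'M[R]_(n, mx)) (W : 'M[R]_(n, mw))
    (y : 'cV[R]_n) (beta : 'cV[R]_mx) (gamma : 'cV[R]_mw) :
  y - X *m beta - W *m gamma = y - row_mx X W *m col_mx beta gamma.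
Proof. by rewrite mul_row_col opprD addrA. Qed.

Lemma ge_inf_range (R : realType) (T : Type) (f : T -> R) (c : R) t :
  (forall u, 0 <= f u) -> f t <= c -> inf (range f) <= c.
Proof.
move=> f0 ftc; apply: le_trans ftc; apply: ge_inf; last by exists t.
by exists 0 => _ [u _ <-].
Qed.

Lemma le_inf_range (R : realType) (T : Type) (t0 : T) (f : T -> R) (c : R) :
  (forall u, c <= f u) -> c <= inf (range f).
Proof.
move=> cf; apply: lb_le_inf; first by exists (f t0); exists t0.
by move=> _ [u _ <-].
Qed.

Lemma selB_row (R : realType) mx mw : selB R mx mw = row_mx 1%:M 0.
Proof. by rewrite /selB pid_mx_row. Qed.

Lemma selB_col (R : realType) mx mw (beta : 'cV[R]_mx) (gamma : 'cV[R]_mw) :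
  selB R mx mw *m col_mx beta gamma = beta.
Proof. by rewrite selB_row mul_row_col mul1mx mul0mx addr0. Qed.

Lemma selB_tr_inj (R : realType) mx mw (u : 'cV[R]_mx) :
  (selB R mx mw)^T *m u = 0 -> u = 0.
Proof.
rewrite selB_row tr_row_mx trmx1 trmx0 mul_col_mx mul1mx mul0mx.
by rewrite -(col_mx0 R mx mw) => /eq_col_mx[].
Qed.

(** A nonpositive K-form bounds one ratio, hence the infimum, by d; if every K-form
    is positive, [ratio_gap] keeps the infimum strictly above d. *)
Lemma AR_le_iff (R : realType) n mx mw k (X : 'M[R]_(n, mx)) (W : 'M[R]_(n, mw))
    (Z : 'M[R]_(n, k)) (y : 'cV[R]_n) (d : R) (beta : 'cV[R]_mx) :
  (mw < k)%N -> (k < n)%N ->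
  (forall gamma, 0 < qform (annm Z) (y - X *m beta - W *m gamma)) ->
  pdmx (W^T *m kmat Z (1 + d) *m W) ->
  (k - mw)%:R * AR X W Z y beta <= (n - k)%:R * d <->
  exists gamma, qform (kmat Z (1 + d)) (y - X *m beta - W *m gamma) <= 0.
Proof.
move=> mk kn qM pW; rewrite kmatE in pW *.
have a0 : 0 < (k - mw)%:R :> R by rewrite ltr0n subn_gt0.
have N0 : 0 < (n - k)%:R :> R by rewrite ltr0n subn_gt0.
rewrite mulrC -ler_pdivlMr//; split=> [ARd|[g qg]].
  apply: contrapT => /forallNP qK.
  have [|e e0 ge] := ratio_gap (projm_sym Z) (annm_psdmx Z).1 pW qM.
    by move=> g; rewrite ltNge; apply/negP/qK.
  suff : (n - k)%:R / (k - mw)%:R * (d + e) <= (n - k)%:R * d / (k - mw)%:R.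
    rewrite mulrAC ler_pM2r ?invr_gt0// ler_pM2l//; lra.
  apply: le_trans ARd; apply: (le_inf_range 0) => g.
  by rewrite ler_pM2l ?divr_gt0.
apply: ge_inf_range (g) _ _ => [u|].
  by rewrite mulr_ge0 ?divr_ge0 ?ler0n ?(projm_psdmx Z).2 ?(annm_psdmx Z).2.
rewrite [leRHS]mulrAC ler_pM2l ?divr_gt0// ler_pdivrMr//.
by move: qg; rewrite qform_subZ; lra.
Qed.

(** Same gap argument as for AR, applied at once to the infimum over beta and
    gamma. *)
Lemma J_LIML_residual_le0 (R : realType) n mx mw k (X : 'M[R]_(n, mx)) (W : 'M[R]_(n, mw))
    (Z : 'M[R]_(n, k)) (y : 'cV[R]_n) (d : R) :
  let S := row_mx X W in
  (mw < k)%N -> (k < n)%N ->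
  (forall b, 0 < qform (annm Z) (y - S *m b)) ->
  pdmx (S^T *m kmat Z (1 + d) *m S) ->
  J_LIML X W Z y <= (n - k)%:R * d ->
  exists b, qform (kmat Z (1 + d)) (y - S *m b) <= 0.
Proof.
move=> S mk kn qM; rewrite kmatE => pS Jd.
have a0 : 0 < (k - mw)%:R :> R by rewrite ltr0n subn_gt0.
have N0 : 0 < (n - k)%:R :> R by rewrite ltr0n subn_gt0.
apply: contrapT => /forallNP qK.
have [|e e0 ge] := ratio_gap (projm_sym Z) (annm_psdmx Z).1 pS qM.
  by move=> g; rewrite ltNge; apply/negP/qK.
suff : (n - k)%:R * (d + e) <= (n - k)%:R * d by rewrite ler_pM2l//; lra.
apply: le_trans Jd; rewrite mulrC -ler_pdivrMl// mulrA; apply: (le_inf_range 0) => beta.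
apply: (le_inf_range 0) => g.
by rewrite residualE mulrAC (mulrC _^-1) ler_pM2l ?divr_gt0//.
Qed.

(** The residuals with fixed beta are the [y - S b] with [B b = beta], so the best
    gamma solves the constrained problem of [constrained_min] for b centered at
    the k-class estimator. *)
Lemma partial_residual_le (R : realType) n mx mw (K : 'M[R]_n) (X : 'M[R]_(n, mx))
    (W : 'M[R]_(n, mw)) (y : 'cV[R]_n) (beta : 'cV[R]_mx) :
  let S := row_mx X W in let B := selB R mx mw in
  let G := S^T *m K *m S in
  K^T = K -> pdmx G ->
  (exists gamma, qform K (y - X *m beta - W *m gamma) <= 0) <->
  qform (invmx (B *m invmx G *m B^T)) (beta - B *m (invmx G *m (S^T *m K *m y))) <=
    - (y^T *m K *m y - y^T *m K *m S *m invmx G *m (S^T *m K *m y)) 0 0.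
Proof.
move=> S B G sK pG.
have res := kclass_residual y _ sK (pdmx_unit pG).
rewrite -(constrained_min _ _ pG (@selB_tr_inj _ _ _)).
split=> [[g]|[u Bu qu]].
  rewrite residualE res => qg; eexists; last first.
    by rewrite -subr_ge0 in qg; rewrite -subr_ge0; move: qg; rewrite sub0r opprD; apply.
  by rewrite mulmxBr selB_col.
pose b := u + invmx G *m (S^T *m K *m y).
have Bb : B *m b = beta by rewrite mulmxDr Bu subrK.
exists (dsubmx b).
have -> : beta = usubmx b by rewrite -Bb -[in LHS](vsubmxK b) selB_col.
by rewrite residualE vsubmxK res addrK; lra.
Qed.

(** * Integrability of the gamma density *)

Lemma is_derive_powR (R : realType) (a t : R) : 0 < t ->
  is_derive t 1 (fun x : R => x `^ a) (a * t `^ (a - 1)).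
Proof.
move=> t0; have it : t \in `]0, +oo[ by rewrite in_itv/= andbT.
rewrite -(powR_derive1 a it) derive1E; apply/derivableP/derivable_powR.
exact: it.
Qed.

(** Distribution function of the log-logistic law.  Its density has the same
    singularity [t `^ (a - 1)] at 0 as the gamma density and only polynomial decay at
    infinity, and its primitive is explicit and bounded: it dominates the
    gamma density near both ends at once. *)
Definition loglogistic_cdf {R : realType} (a t : R) : R := 1 - (1 + t `^ a)^-1.
Definition loglogistic_pdf {R : realType} (a t : R) : R := a * t `^ (a - 1) / (1 + t `^ a) ^+ 2.

Lemma powR1D_gt0 (R : realType) (a t : R) : 0 < 1 + t `^ a.
Proof. by rewrite ltr_wpDr// powR_ge0. Qed.

Lemma is_derive_loglogistic_cdf (R : realType) (a t : R) : 0 < t ->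
  is_derive t 1 (loglogistic_cdf a) (loglogistic_pdf a t).
Proof.
move=> t0; have dp := is_derive_powR a t0.
have dd : is_derive t 1 (cst 1 + (fun x : R => x `^ a)) (0 + a * t `^ (a - 1)).
  by apply: is_deriveD.
have n0 : (cst 1 + (fun x : R => x `^ a)) t != 0.
  by apply: lt0r_neq0; exact: powR1D_gt0.
have := is_deriveD (is_derive_cst (1 : R) t 1) (is_deriveN (is_deriveV n0 dd)).
set D := (X in is_derive _ _ _ X -> _).
have -> // : D = loglogistic_pdf a t.
rewrite /D /loglogistic_pdf /cst !add0r /= -[LHS]/(- (- (1 + t `^ a) ^- 2 * (a * t `^ (a - 1)))).
by rewrite mulNr opprK mulrC.
Qed.

Lemma continuous_loglogistic_pdf (R : realType) (a t : R) : 0 < t ->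
  {for t, continuous (loglogistic_pdf a)}.
Proof.
move=> t0; have cp b : {for t, continuous (fun x : R => x `^ b)}.
  apply: differentiable_continuous; apply/derivable1_diffP.
  exact: (@ex_derive _ _ _ _ _ _ _ (is_derive_powR b t0)).
have cd : {for t, continuous (fun x : R => 1 + x `^ a)}.
  by apply: cvgD; [exact: cvg_cst|exact: cp].
apply: cvgM; first by apply: cvgM; [exact: cvg_cst|exact: cp].
apply: cvgV; first by rewrite expf_neq0// lt0r_neq0// powR1D_gt0.
rewrite (_ : (fun x => _) = (fun x : R => (1 + x `^ a) * (1 + x `^ a))).
  exact: cvgM.
by apply/funext => x; rewrite expr2.
Qed.

Lemma measurable_loglogistic_pdf (R : realType) (a : R) (D : set R) :
  measurable_fun D (loglogistic_pdf a).
Proof.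
apply: measurable_funTS.
have mp b : measurable_fun [set: R] (fun x : R => x `^ b) := measurable_powR b.
rewrite (_ : loglogistic_pdf a = (fun t => a * t `^ (a - 1) * ((1 + t `^ a) ^+ 2) `^ (-1))).
  apply: measurable_funM; first by apply: measurable_funM => //; exact: mp.
  apply: (measurableT_comp (measurable_powR (-1))).
  by apply: measurable_funX; apply: measurable_funD => //; exact: mp.
by apply/funext => t; rewrite /loglogistic_pdf powR_inv1// exprn_ge0 ?ltW ?powR1D_gt0.
Qed.

Lemma loglogistic_pdf_ge0 (R : realType) (a t : R) : 0 < a -> 0 <= loglogistic_pdf a t.
Proof.
by move=> a0; rewrite /loglogistic_pdf divr_ge0 ?mulr_ge0 ?powR_ge0 ?exprn_ge0 ?ltW ?powR1D_gt0.
Qed.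

Lemma integral_loglogistic_pdf (R : realType) (a b c : R) : 0 < b -> b < c ->
  (\int[@lebesgue_measure R]_(x in `[b, c]) (loglogistic_pdf a x)%:E =
   (loglogistic_cdf a c)%:E - (loglogistic_cdf a b)%:E)%E.
Proof.
move=> b0 bc.
have cF t : 0 < t -> {for t, continuous (loglogistic_cdf a)}.
  move=> t0; apply: differentiable_continuous; apply/derivable1_diffP.
  exact: (@ex_derive _ _ _ _ _ _ _ (is_derive_loglogistic_cdf a t0)).
apply: continuous_FTC2 => //.
- apply: continuous_in_subspaceT => x; rewrite inE/= in_itv/= => /andP[bx _].
  by apply: continuous_loglogistic_pdf; exact: lt_le_trans bx.
- split.
  + move=> x; rewrite in_itv/= => /andP[bx _].
    exact: (@ex_derive _ _ _ _ _ _ _ (is_derive_loglogistic_cdf a (lt_trans b0 bx))).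
  + by apply: cvg_at_right_filter; exact: cF.
  + by apply: cvg_at_left_filter; apply: cF; exact: lt_trans bc.
- move=> x; rewrite in_itv/= => /andP[bx _]; rewrite derive1E.
  exact: (@derive_val _ _ _ _ _ _ _ (is_derive_loglogistic_cdf a (lt_trans b0 bx))).
Qed.

(** The density may blow up at 0, so it is integrated over compact intervals that
    exhaust the half-line; there its integral is an increment of the
    distribution function, hence at most 1. *)
Lemma integrable_loglogistic_pdf (R : realType) (a : R) : 0 < a ->
  (@lebesgue_measure R).-integrable `]0, +oo[ (EFin \o loglogistic_pdf a).
Proof.
move=> a0.
(* starting at 2 makes every interval nondegenerate *)
pose F (i : nat) : set R := `[i.+2%:R^-1, i.+2%:R]%classic.
have FE : `]0, +oo[%classic = \bigcup_i F i.
  apply/seteqP; split=> x /=; rewrite in_itv/= ?andbT.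
    move=> x0; exists (maxn (Num.truncn x) (Num.truncn x^-1)) => //=.
    set N := maxn _ _.
    have xN : x <= N.+2%:R.
      apply: le_trans (ltW (truncnS_gt x)) _; rewrite ler_nat ltnS.
      by apply: leqW; exact: leq_maxl.
    have xN' : x^-1 <= N.+2%:R.
      apply: le_trans (ltW (truncnS_gt x^-1)) _; rewrite ler_nat ltnS.
      by apply: leqW; exact: leq_maxr.
    by rewrite /F /= in_itv/= xN andbT invf_ple// posrE.
  by move=> [i _]; rewrite /F /= in_itv/= => /andP[ix _]; apply: lt_le_trans ix.
have ndF : nondecreasing_seq F.
  apply/nondecreasing_seqP => i; rewrite subsetEset => x; rewrite /F /= !in_itv/=.
  move=> /andP[ix xi]; apply/andP; split.
    by apply: le_trans ix; rewrite lef_pV2 ?posrE// ler_nat.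
  by apply: le_trans xi _; rewrite ler_nat.
apply/integrableP; split; first by apply/measurable_EFinP; exact: measurable_loglogistic_pdf.
rewrite FE.
have mS D : measurable_fun D (fun x => `|(loglogistic_pdf a x)%:E|%E).
  by apply: measurableT_comp => //; apply/measurable_EFinP; exact: measurable_loglogistic_pdf.
have cv : ((fun i => \int[@lebesgue_measure R]_(x in F i) `|(loglogistic_pdf a x)%:E|) @ \oo -->
           \int[@lebesgue_measure R]_(x in \bigcup_i F i) `|(loglogistic_pdf a x)%:E|)%E.
  apply: ge0_nondecreasing_set_cvg_integral => // i; [exact: measurable_itv|exact: mS].
apply: (@le_lt_trans _ _ 1%E); last exact: ltry.
rewrite -(cvg_lim _ cv)//; apply: lime_le; first by apply/cvg_ex; eexists; exact: cv.
apply: nearW => i.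
have -> : (\int[@lebesgue_measure R]_(x in F i) `|(loglogistic_pdf a x)%:E| =
         \int[@lebesgue_measure R]_(x in F i) (loglogistic_pdf a x)%:E)%E.
  by apply: eq_integral => x _; rewrite gee0_abs// lee_fin loglogistic_pdf_ge0.
rewrite integral_loglogistic_pdf//; last first.
  by rewrite (@lt_trans _ _ 1)// ?invf_lt1// ltr1n.
rewrite -EFinB lee_fin /loglogistic_cdf.
have h1 : 0 <= (1 + i.+2%:R `^ a)^-1 by rewrite invr_ge0 ltW// powR1D_gt0.
have h2 : (1 + i.+2%:R^-1 `^ a)^-1 <= 1.
  by rewrite invf_le1 ?powR1D_gt0// lerDl powR_ge0.
lra.
Qed.

(** Both factors of the left side are at most [2 (1 + t) `^ a], and
    [1 + t <= M (1 + b t / p) <= M expR (b t / p)] raised to a power p > 2 a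
    gives the exponential. *)
Lemma expR_dominates (R : realType) (a b : R) : 0 < a -> 0 < b ->
  exists2 C : R, 0 < C & forall t : R, 0 < t -> (1 + t `^ a) ^+ 2 <= C * expR (b * t).
Proof.
move=> a0 b0; pose p := 2 * a + 1; pose M := 1 + p / b.
have p0 : 0 < p by rewrite /p; lra.
have M1 : 1 <= M by rewrite lerDl divr_ge0 ?ltW.
have M0 : 0 < M by apply: lt_le_trans M1.
exists (4 * M `^ p); first by rewrite mulr_gt0// powR_gt0.
move=> t t0.
have t1 : 1 <= 1 + t by rewrite lerDl ltW.
have h1 : 1 + t `^ a <= 2 * (1 + t) `^ a.
  have : 1 <= (1 + t) `^ a.
    by rewrite -[leLHS](powRr0 (1 + t)); apply: ler_powR => //; exact: ltW.
  have : t `^ a <= (1 + t) `^ a.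
    by apply: ge0_ler_powR; rewrite ?nnegrE ?ltW ?addr_gt0// ltrDr.
  lra.
have h2 : ((1 + t) `^ a) ^+ 2 <= (1 + t) `^ p.
  rewrite -powR_mulrn ?powR_ge0// -powRrM; apply: ler_powR => //.
  by rewrite /p; lra.
have h3 : (1 + t) `^ p <= M `^ p * expR (b * t).
  have -> : expR (b * t) = expR (b * t / p) `^ p.
    rewrite /powR gt_eqF ?expR_gt0// expRK; congr expR; field; exact: lt0r_neq0.
  rewrite -powRM; [|exact: ltW|exact: expR_ge0].
  apply: ge0_ler_powR; first exact: ltW.
  - by rewrite nnegrE addr_ge0// ltW.
  - by rewrite nnegrE mulr_ge0 ?expR_ge0// ltW.
  apply: (@le_trans _ _ (M * (1 + b * t / p))); last by rewrite ler_pM2l// expR_ge1Dx.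
  have -> : M * (1 + b * t / p) = 1 + t + p / b + b * t / p.
    by rewrite /M; field; rewrite !gt_eqF.
  by rewrite -addrA lerDl addr_ge0// divr_ge0 ?mulr_ge0 ?ltW.
apply: (@le_trans _ _ ((2 * (1 + t) `^ a) ^+ 2)).
  by rewrite lerXn2r// nnegrE ?mulr_ge0 ?powR_ge0// ltW// powR1D_gt0.
rewrite exprMn -mulrA (_ : 2 ^+ 2 = 4 :> R); last by rewrite -natrX.
by rewrite ler_pM2l//; exact: le_trans h3.
Qed.

(** The quotient by the log-logistic density is bounded, by [expR_dominates]. *)
Lemma integrable_gamma_density (R : realType) (a b : R) : 0 < a -> 0 < b ->
  (@lebesgue_measure R).-integrable `]0, +oo[
    (EFin \o (fun t : R => t `^ (a - 1) * expR (- (b * t)))).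
Proof.
move=> a0 b0; have [C C0 hC] := expR_dominates a0 b0.
have iS : (@lebesgue_measure R).-integrable `]0, +oo[
    (fun t => (C / a)%:E * (EFin \o loglogistic_pdf a) t)%E.
  by apply: integrableZl => //; exact: integrable_loglogistic_pdf.
apply: le_integrable iS => //.
  apply/measurable_EFinP; apply: measurable_funTS; apply: measurable_funM.
    exact: measurable_powR.
  apply: measurableT_comp => //; apply: measurableT_comp => //.
move=> t /=; rewrite in_itv/= andbT => t0.
rewrite !lee_fin ger0_norm ?mulr_ge0 ?powR_ge0 ?expR_ge0//.
rewrite ger0_norm; last by rewrite mulr_ge0 ?loglogistic_pdf_ge0 ?divr_ge0 ?ltW.
rewrite /loglogistic_pdf mulrA -(mulrA (C / a)) -!mulrA (mulrA a^-1) mulVf ?lt0r_neq0// mul1r.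
rewrite mulrCA ler_wpM2l ?powR_ge0// ler_pdivlMr ?exprn_gt0 ?powR1D_gt0//.
by rewrite expRN mulrC ler_pdivrMr ?expR_gt0// hC.
Qed.

(** * Inverting the chi-square distribution function *)

Lemma Rintegral_gt0 d (T : measurableType d) (R : realType)
    (mu : {measure set T -> \bar R}) (D : set T) (f : T -> R) :
  measurable D -> (0 < mu D)%E -> mu.-integrable D (EFin \o f) ->
  (forall x, D x -> 0 < f x) -> 0 < \int[mu]_(x in D) f x.
Proof.
move=> mD muD iF f0.
rewrite lt_def Rintegral_ge0 ?andbT; last by move=> x /f0/ltW.
apply/eqP => If0; move: muD; rewrite lt0e => /andP[/eqP + _]; apply.
have mf : measurable_fun D (EFin \o f) := measurable_int mu iF.
have : (\int[mu]_(x in D) `|(EFin \o f) x| = 0)%E.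
  rewrite (eq_integral (EFin \o f)); last first.
    by move=> x; rewrite inE => Dx; rewrite /= ger0_norm// ltW// f0.
  by rewrite -(fineK (integrable_fin_num mD iF)) -[fine _]/(Rintegral mu D f) If0.
move=> /(ae_eq_integral_abs mu mD mf) [B [mB B0 DB]].
apply: (subset_measure0 mD mB _ B0) => x Dx; apply: DB => /= /(_ Dx) [] fx0.
by have := f0 x Dx; rewrite fx0 ltxx.
Qed.

Lemma gamma_fun_gt0 (R : realType) (a : R) : 0 < a -> 0 < gamma_fun a.
Proof.
move=> a0; rewrite /gamma_fun; apply: Rintegral_gt0 => //.
- have : (0 < @lebesgue_measure R `]0%R, +oo[%classic)%E.
    by rewrite lebesgue_measure_itv/= ltry ltry.
  exact.
- have := integrable_gamma_density a0 ltr01.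
  by under [X in EFin \o X]eq_fun do rewrite mul1r.
- by move=> x; rewrite /= in_itv/= andbT => x0; rewrite mulr_gt0 ?powR_gt0 ?expR_gt0.
Qed.

Lemma chi2_pdf_gt0 (R : realType) (r : nat) (t : R) : (0 < r)%N -> 0 < t ->
  0 < chi2_pdf r t.
Proof.
move=> r0 t0; have h : 0 < r%:R / 2 :> R by rewrite divr_gt0 ?ltr0n.
rewrite /chi2_pdf t0 divr_gt0 ?mulr_gt0 ?powR_gt0 ?expR_gt0 ?gamma_fun_gt0//.
Qed.

Lemma integrable_chi2_pdf (R : realType) (r : nat) (D : set R) : (0 < r)%N ->
  measurable D ->
  (@lebesgue_measure R).-integrable D (EFin \o @chi2_pdf R r).
Proof.
move=> r0 mD; apply: (@integrableS _ _ _ _ setT) => //.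
have h : 0 < r%:R / 2 :> R by rewrite divr_gt0 ?ltr0n.
have h2 : 0 < 2^-1 :> R by rewrite invr_gt0.
pose c : R := (2 `^ (r%:R / 2) * gamma_fun (r%:R / 2))^-1.
have iG : (@lebesgue_measure R).-integrable `]0, +oo[
    (fun t => c%:E * (EFin \o (fun t => t `^ (r%:R / 2 - 1) * expR (- (2^-1 * t)))%R) t)%E.
  by apply: integrableZl => //; exact: integrable_gamma_density.
move: iG => /integrable_mkcond => /(_ (measurable_itv _)).
congr (integrable _ _ _).
apply/funext => t; rewrite patchE mem_setE in_itv/= andbT /chi2_pdf.
by case: ifP => // _; rewrite -EFinM /c mulrC (mulrC 2^-1).
Qed.

(** Integrability matters here because the integral of a function that is not
    integrable may be the default value 0. *)
Lemma chi2_cdf_lt (R : realType) (r : nat) (x y : R) : (0 < r)%N -> 0 <= x -> x < y ->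
  chi2_cdf r x < chi2_cdf r y.
Proof.
move=> r0 x0 xy; rewrite -subr_gt0 /chi2_cdf.
rewrite Rintegral_itvB//; first last.
- by rewrite bnd_simp ltW.
- exact: integrable_chi2_pdf.
apply: Rintegral_gt0 => //.
- have : (0 < @lebesgue_measure R `]x, y]%classic)%E.
    by rewrite lebesgue_measure_itv/= lte_fin xy -EFinD lte_fin subr_gt0.
  exact.
- exact: integrable_chi2_pdf.
- move=> t; rewrite /= in_itv/= => /andP[xt _].
  by apply: chi2_pdf_gt0 => //; exact: le_lt_trans xt.
Qed.

(** Strict monotonicity on the half-line makes t the least nonnegative point
    where the distribution function reaches its value at t. *)
Lemma chi2_cdfK (R : realType) (r : nat) (t : R) : (0 < r)%N -> 0 <= t ->
  chi2_quantile r (chi2_cdf r t) = t.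
Proof.
move=> r0 t0; apply/eqP; rewrite eq_le; apply/andP; split.
  by apply: ge_inf; [exists 0 => x [] | split].
apply: lb_le_inf; first by exists t; split.
move=> x [x0 Ftx]; rewrite leNgt; apply/negP => xt.
by have := chi2_cdf_lt r0 x0 xt; rewrite ltNge Ftx.
Qed.

(** * Equality of the confidence sets *)

Theorem proposition3 (R : realType) (n mx mw k : nat)
    (y : 'cV[R]_n) (X : 'M[R]_(n, mx)) (W : 'M[R]_(n, mw)) (Z : 'M[R]_(n, k))
    (alpha : R)
    (hmx : (0 < mx)%N) (hmk : (mx + mw <= k)%N) (hkn : (k < n)%N)
    (halpha0 : 0 < alpha) (halpha1 : alpha <= 1)
    (hinv : let Sy := row_mx (row_mx X W) y in Sy^T *m annm Z *m Sy \in unitmx)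
    (hJ : J_LIML X W Z y <= chi2_quantile (k - mw) (1 - alpha))
    (hlambda : chi2_quantile (k - mw) (1 - alpha) < lambda_stat (row_mx X W) Z) :
  CI_AR X W Z y (1 - alpha) = CI_LR X W Z y (1 - alpha_LR_AR X W Z y alpha)
  /\ CI_LR X W Z y (1 - alpha_LR_AR X W Z y alpha)
     = CI_Wald X W Z y (kappa_AR n k mw alpha) (1 - alpha_Wald_AR X W Z y alpha).
Proof.
have eLR : CI_AR X W Z y (1 - alpha) = CI_LR X W Z y (1 - alpha_LR_AR X W Z y alpha).
  rewrite /CI_AR /CI_LR /alpha_LR_AR subKr chi2_cdfK ?subr_ge0//.
  by apply/funext => beta; rewrite /= /LR mulrBr lerD2r.
split; first exact: eLR.
rewrite -eLR; rewrite /= in hinv.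
set S := row_mx X W in hinv hlambda *.
set c := chi2_quantile _ _ in hJ hlambda.
have mk : (mw < k)%N by apply: leq_trans hmk; rewrite -addn1 addnC leq_add2r.
have N0 : 0 < (n - k)%:R :> R by rewrite ltr0n subn_gt0.
pose d := c / (n - k)%:R.
have cE : c = (n - k)%:R * d by rewrite mulrC divfK ?gt_eqF.
have kE : kappa_AR n k mw alpha = 1 + d by [].
have [pD Mpos] := unitmx_residual_gt0 (annm_psdmx Z) hinv.
pose K := kmat Z (1 + d); pose G := S^T *m K *m S.
have sK : K^T = K by rewrite /K kmatE linearB linearZ /= projm_sym (annm_psdmx Z).1.
have pG : pdmx G.
  rewrite /G /K kmatE mulmxBr mulmxBl -scalemxAr -scalemxAl.
  apply: pdmx_lambda_min (psdmx_congr S (projm_psdmx Z)) pD _.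
  by rewrite -(ltr_pM2l N0) -cE.
have pW : pdmx (W^T *m K *m W).
  have := @pdmx_congr _ _ _ _ (col_mx (0 : 'M[R]_(mx, mw)) 1%:M) pG.
  rewrite /G !mulmxA -trmx_mul -!(mulmxA _ S) mul_row_col mulmx0 add0r mulmx1.
  apply=> u; rewrite mul_col_mx mul0mx mul1mx -(col_mx0 R mx mw).
  by move=> /eq_col_mx[].
have bE : beta_k S Z y (1 + d) = invmx G *m (S^T *m K *m y).
  by rewrite /beta_k mpinv_unitmx ?pdmx_unit.
(* J_LIML <= c provides a residual with nonpositive K-form, and s is below it *)
have s0 : s_k S Z y (1 + d) <= 0.
  have [b] : exists b, qform K (y - S *m b) <= 0.
    apply: (J_LIML_residual_le0 mk hkn Mpos pG); rewrite -cE; exact: hJ.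
  rewrite (kclass_residual _ _ sK (pdmx_unit pG)) => /(le_trans _); apply.
  by rewrite lerDl (pdmx_psdmx pG).2.
have sig0 : 0 < sigma2_Wald S Z y (1 + d).
  rewrite /sigma2_Wald; apply: mulr_gt0.
    by rewrite invr_gt0 ltr0n subn_gt0 (leq_ltn_trans hmk).
  have /eqP v0 : y - S *m beta_k S Z y (1 + d) != 0.
    apply/eqP => v0; have := Mpos (beta_k S Z y (1 + d)).
    by rewrite v0 /qform mulmx0 mxE ltxx.
  have p1 : pdmx (1%:M : 'M[R]_n).
    apply: psdmx_unit_pdmx; last exact: unitmx1.
    by apply: idempotent_psdmx; rewrite ?trmx1 ?mulmx1.
  exact/p1.2/eqP.
have qE : chi2_quantile mx (1 - alpha_Wald_AR X W Z y alpha) =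
    - s_k S Z y (1 + d) / sigma2_Wald S Z y (1 + d).
  rewrite /alpha_Wald_AR subKr kE.
  apply: chi2_cdfK; first exact: hmx.
  by apply: divr_ge0; [rewrite oppr_ge0|exact: ltW].
rewrite /CI_Wald kE qE.
apply/funext => beta; apply/propext; rewrite /CI_AR /mkset -/c cE.
have Mg g : 0 < qform (annm Z) (y - X *m beta - W *m g) by rewrite residualE.
rewrite (AR_le_iff mk hkn Mg pW).
rewrite (@partial_residual_le _ _ _ _ K X W y beta sK pG) /Wald -/S bE -/K -/G.
rewrite (mulrC (sigma2_Wald S Z y (1 + d))^-1) ler_pM2r; last by rewrite invr_gt0.
exact: iff_refl.
Qed.
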